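(* Let $\Omega$ be a bounded, convex, open subset of $\mathbb{R}^2$ and $M$ a minimal two-phase partitioning of $\Omega$ with length $L$. Assume there is a neighborhood of the points $\partial M$ in $\Sigma=\partial\Omega$ which is a $C^2$ curve and that the curvatures of $\Sigma$ at these points are $\sigma_1$, $\sigma_2$. If $L=|M|$ is sufficiently small, then $M$ is stable.
   Context: In dimension 2 the interface $M$ is a curve of length $L$ with its two endpoints on $\Sigma$, dividing $\Omega$ into two phases. It is minimal if the first variation of length vanishes for all variations preserving $\Sigma$ and the areas of the phases; then $M$ is a line segment or circular arc of constant curvature $\kappa\geqslant0$ ($\kappa=1/R$ for an arc of radius $R$, $\kappa=0$ for a segment) meeting $\Sigma$ orthogonally. Parametrize $M$ by arc length $s\in[0,L]$; $\sigma_1$ is the curvature of $\Sigma$ at the endpoint $s=0$ and $\sigma_2$ at $s=L$ (nonnegative for convex $\Omega$). The second variation of area for a normal variation with normal component $f$ is $$J(f)=\int_0^L\left(f'(s)^2-\kappa^2f(s)^2\right)ds-\sigma_1f(0)^2-\sigma_2f(L)^2.$$ $M$ is stable if $J(f)>0$ for all admissible $f\neq0$, admissibility including the volume constraint $\int_0^Lf\,ds=0$. *)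

(* Defs.v *)
From HB Require Import structures.
From mathcomp Require Export all_boot all_order all_algebra.
From mathcomp Require Export all_classical all_reals all_analysis.
Export Order.TTheory GRing.Theory Num.Theory.
Export numFieldNormedType.Exports.

Set Implicit Arguments.
Unset Strict Implicit.
Unset Printing Implicit Defensive.

Local Open Scope classical_set_scope.
Local Open Scope ring_scope.

(* In finite dimension, existence and continuity of all directional derivatives
   is equivalent to being continuously Frechet differentiable.  Maps of class
   C^k on a compact interval are represented below by C^k extensions to R;
   only the values on the interval enter the definitions. *)
Definition classC1 (R : realType) (V W : normedModType R) (f : V -> W) : Prop :=
  forall v : V, (forall x : V, derivable f x v) /\ continuous ('D_v f).

Definition classC2 (R : realType) (V W : normedModType R) (f : V -> W) : Prop :=
  classC1 f /\ forall v : V, classC1 ('D_v f).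

(* The library norm on R * R is the sup norm; lengths and angles use the
   Euclidean structure. *)
Definition dot (R : realType) (u v : R * R) : R := u.1 * v.1 + u.2 * v.2.

Definition enorm (R : realType) (u : R * R) : R := Num.sqrt (dot u u).

Definition boundary (T : topologicalType) (A : set T) : set T :=
  closure A `\` interior A.

Definition area (R : realType) (A : set (R * R)) : \bar R :=
  (@lebesgue_measure R \x @lebesgue_measure R)%E A.

Definition curve_length (R : realType) (c : R -> R * R) (a b : R) : R :=
  \int[@lebesgue_measure R]_(s in `[a, b]) enorm (derive1 c s).

(* Near p, the boundary of Omega is a C^2 curve, whose curvature at p with
   respect to the inward unit normal nu is sigma (so sigma >= 0 if Omega is
   convex). *)
Definition boundary_C2_curvature (R : realType) (Omega : set (R * R))
    (p : R * R) (sigma : R) : Prop :=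
  exists (c : R -> R * R) (e : R) (U : set (R * R)) (nu : R * R),
    [/\ 0 < e, nbhs p U, classC2 c & c 0 = p] /\
    [/\ c @` `]- e, e[ = boundary Omega `&` U,
        {in `]- e, e[ &, injective c} &
        {in `]- e, e[, forall s, enorm (derive1 c s) = 1}] /\
    [/\ enorm nu = 1, dot nu (derive1 c 0) = 0,
        \forall t \near 0^'+, Omega (p + t *: nu) &
        dot (derive1 (derive1 c) 0) nu = sigma].

(* M is the image of [0, L] under the arc-length parametrization gamma; A and B
   are the two phases. *)
Definition two_phase_partition (R : realType) (Omega A B : set (R * R))
    (gamma : R -> R * R) (L : R) : Prop :=
  [/\ 0 < L, classC2 gamma, {in `[0, L] &, injective gamma} &
      {in `[0, L], forall s, enorm (derive1 gamma s) = 1}] /\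
  [/\ boundary Omega (gamma 0), boundary Omega (gamma L) &
      {in `]0, L[, forall s, Omega (gamma s)}] /\
  [/\ open A /\ open B, A !=set0 /\ B !=set0, A `&` B = set0 &
      A `|` B = Omega `\` gamma @` `[0, L]].

(* One-parameter families of C^2 diffeomorphisms of the plane, starting at the
   identity and preserving Omega, Sigma and the areas of the phases. *)
Definition admissible_variation (R : realType) (Omega A B : set (R * R))
    (Phi : R -> R * R -> R * R) : Prop :=
  [/\ classC2 (fun z : R * (R * R) => Phi z.1 z.2),
      Phi 0 =1 id,
      \forall t \near (0 : R), exists Psi : R * R -> R * R,
        [/\ classC2 Psi, cancel (Phi t) Psi & cancel Psi (Phi t)],
      \forall t \near (0 : R),
        Phi t @` Omega = Omega /\ Phi t @` boundary Omega = boundary Omega &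
      \forall t \near (0 : R),
        area (Phi t @` A) = area A /\ area (Phi t @` B) = area B].

Definition minimal_partition (R : realType) (Omega A B : set (R * R))
    (gamma : R -> R * R) (L : R) : Prop :=
  two_phase_partition Omega A B gamma L /\
  forall Phi : R -> R * R -> R * R, admissible_variation Omega A B Phi ->
    is_derive (0 : R) (1 : R)
      (fun t : R => curve_length (fun s => Phi t (gamma s)) 0 L) (0 : R).

Definition constant_curvature (R : realType) (gamma : R -> R * R) (L kappa : R)
  : Prop := {in `[0, L], forall s, enorm (derive1 (derive1 gamma) s) = kappa}.

Definition second_variation (R : realType) (kappa sigma1 sigma2 L : R)
    (f : R -> R) : R :=
  \int[@lebesgue_measure R]_(s in `[0, L])
     (derive1 f s ^+ 2 - kappa ^+ 2 * f s ^+ 2)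
  - sigma1 * f 0 ^+ 2 - sigma2 * f L ^+ 2.

Definition admissible_normal_component (R : realType) (L : R) (f : R -> R)
  : Prop :=
  classC1 f /\ \int[@lebesgue_measure R]_(s in `[0, L]) f s = 0.

Definition stable (R : realType) (kappa sigma1 sigma2 L : R) : Prop :=
  forall f : R -> R, admissible_normal_component L f ->
    (exists2 s, s \in `[0, L] & f s <> 0) ->
    0 < second_variation kappa sigma1 sigma2 L f.

(* Main.v *)
Require Import Defs.
From mathcomp Require Import ring lra.

Set Implicit Arguments.
Unset Strict Implicit.
Unset Printing Implicit Defensive.

Local Open Scope classical_set_scope.
Local Open Scope ring_scope.

(** For a mean-zero [f] on [[0, L]], a zero of [f] and the Cauchy-Schwarz
    inequality give [f(s)^2 <= L I] with [I] the integral of [f'^2].  Hence the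
    second variation is at least
    [(1 - kappa^2 L^2 - (|sigma1| + |sigma2|) L) I], which is positive for small
    [L].  Integrals are handled through antiderivatives, so that each comparison
    is a monotonicity statement. *)

Lemma is_derive_ge0_le (R : realType) (F dF : R -> R) (a b : R) : a <= b ->
  {in `[a, b], forall x : R, is_derive x 1 F (dF x)} ->
  {in `[a, b], forall x, 0 <= dF x} -> F a <= F b.
Proof.
move=> ab dFE dF0.
have cF : {within `[a, b], continuous F}.
  apply: derivable_within_continuous => x xab.
  by have [] := dFE x xab.
have dFo x : x \in `]a, b[%R -> is_derive x 1 F (dF x).
  by move=> xab; apply: dFE; apply: subset_itv_oo_cc xab.
have [c cab E] := MVT_segment ab dFo cF.
by rewrite -subr_ge0 E mulr_ge0 ?dF0 ?subr_ge0.
Qed.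

Lemma continuous_antiderivative (R : realType) (g : R -> R) (a b : R) :
  a < b -> continuous g ->
  exists2 G : R -> R, {in `[a, b], forall x : R, is_derive x 1 G (g x)} &
    \int[@lebesgue_measure R]_(x in `[a, b]) g x = G b - G a.
Proof.
move=> ab gc.
(* The integral starts at [a - 1], and integrability is taken up to [b + 1], so that [a] and [b] are
   interior points and [G] has a two-sided derivative there as well. *)
pose G x := \int[@lebesgue_measure R]_(t in `[a - 1, x]) g t.
have dG x : x \in `[a, b] -> is_derive x 1 G (g x).
  rewrite in_itv/= => /andP[ax xb].
  have xb1 : x < b + 1 by lra.
  have ax1 : a - 1 < x by lra.
  have gi : (@lebesgue_measure R).-integrable `[a - 1, b + 1] (EFin \o g).
    apply: continuous_compact_integrable; first exact: segment_compact.
    exact: continuous_subspaceT.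
  have [dG GE] := continuous_FTC1_closed xb1 gi ax1 (gc x).
  by split=> //; rewrite -derive1E.
exists G => //.
have Gc x : x \in `[a, b] -> {for x, continuous G}.
  move=> /dG[dGx _]; exact/differentiable_continuous/derivable1_diffP.
rewrite /Rintegral (@continuous_FTC2 _ g G)//.
- exact: continuous_subspaceT.
- split.
  + by move=> x xab; have [] := dG x (subset_itv_oo_cc xab).
  + by apply: cvg_at_right_filter; apply: Gc; rewrite in_itv/= lexx ltW.
  + by apply: cvg_at_left_filter; apply: Gc; rewrite in_itv/= lexx ltW.
- move=> x xab; have [_ <-] := dG x (subset_itv_oo_cc xab).
  by rewrite derive1E.
Qed.

(** Rolle's theorem for an antiderivative of [f]: the vanishing integral makes its values at [a] and
    [b] equal. *)
Lemma Rintegral_eq0_root (R : realType) (f : R -> R) (a b : R) :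
  a < b -> continuous f ->
  \int[@lebesgue_measure R]_(x in `[a, b]) f x = 0 ->
  exists2 c, c \in `[a, b] & f c = 0.
Proof.
move=> ab fc; have [F dF ->] := continuous_antiderivative ab fc => /eqP.
rewrite subr_eq0 => /eqP Fba.
have [| |c cab [_ Fc]] := Rolle ab _ _ (esym Fba).
- by move=> x xab; have [] := dF x (subset_itv_oo_cc xab).
- by apply: derivable_within_continuous => x xab; have [] := dF x xab.
exists c; first exact: subset_itv_oo_cc.
by have [_ <-] := dF c (subset_itv_oo_cc cab).
Qed.

(* Cauchy-Schwarz: [G - 2 k f + k^2 x] has derivative [(df - k)^2], for the mean
   slope [k] of [f]. *)
Lemma sqr_increment_le (R : realType) (f df G : R -> R) (a b : R) : a <= b ->
  {in `[a, b], forall x : R, is_derive x 1 f (df x)} ->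
  {in `[a, b], forall x : R, is_derive x 1 G (df x ^+ 2)} ->
  (f b - f a) ^+ 2 <= (b - a) * (G b - G a).
Proof.
rewrite le_eqVlt => /predU1P[->|ab] dfE dGE.
  by rewrite !subrr expr0n mul0r.
have ba : 0 < b - a by rewrite subr_gt0.
pose k := (f b - f a) / (b - a).
have kE : f b - f a = k * (b - a) by rewrite /k divfK// gt_eqF.
pose H : R -> R := G - (2 * k) *: f + (k ^+ 2) *: id.
have dH : {in `[a, b], forall x : R, is_derive x 1 H ((df x - k) ^+ 2)}.
  move=> x xab; have df' := dfE x xab; have dG' := dGE x xab.
  apply: is_derive_eq; rewrite /GRing.scale/=; ring.
have := is_derive_ge0_le (ltW ab) dH (fun x _ => sqr_ge0 _).
rewrite /H !fctE /GRing.scale/= => Hab.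
(* This is [H a <= H b] once [2 * k * (f b - f a)] is rewritten as [2 * k ^+ 2 * (b - a)];
   multiplying by [b - a] then gives the claim. *)
have : k ^+ 2 * (b - a) <= G b - G a.
  have := congr1 (fun z => 2 * k * z) kE; lra.
by rewrite -(ler_pM2l ba) kE; lra.
Qed.

(** Since [f] vanishes at some [c], [f s] is, up to sign, an increment of [f] between [c] and [s].
    Cauchy-Schwarz bounds its square on that subinterval, and both factors grow when it is enlarged
    to [[0, L]], as [G] is nondecreasing. *)
Lemma mean_zero_sqr_le (R : realType) (f G : R -> R) (L : R) : 0 < L ->
  {in `[0, L], forall x : R, derivable f x 1} -> continuous f ->
  {in `[0, L], forall x : R, is_derive x 1 G (derive1 f x ^+ 2)} ->
  \int[@lebesgue_measure R]_(x in `[0, L]) f x = 0 ->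
  {in `[0, L], forall s, f s ^+ 2 <= L * (G L - G 0)}.
Proof.
move=> L0 df fc dG f0 s s0L.
have [c c0L fc0] := Rintegral_eq0_root L0 fc f0.
have dfE : {in `[0, L], forall x : R, is_derive x 1 f (derive1 f x)}.
  by move=> x /df dfx; rewrite derive1E; exact: DeriveDef.
have Gle u v : 0 <= u -> u <= v -> v <= L -> G u <= G v.
  move=> u0 uv vL.
  apply: (@is_derive_ge0_le _ _ (fun x => derive1 f x ^+ 2)) => //.
    move=> x; rewrite in_itv/= => /andP[ux xv].
    by apply: dG; rewrite in_itv/=; lra.
  by move=> x _; exact: sqr_ge0.
have key u v : 0 <= u -> u <= v -> v <= L ->
    (f v - f u) ^+ 2 <= L * (G L - G 0).
  move=> u0 uv vL.
  have sub x : x \in `[u, v] -> x \in `[0, L].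
    by rewrite !in_itv/= => /andP[ux xv]; lra.
  have := sqr_increment_le uv (fun x xuv => dfE x (sub x xuv))
                              (fun x xuv => dG x (sub x xuv)).
  move/le_trans; apply.
  have := Gle 0 u (lexx _) u0 (le_trans uv vL).
  have := Gle u v u0 uv vL; have := Gle v L (le_trans u0 uv) vL (lexx _).
  by move=> *; apply: ler_pM; rewrite ?subr_ge0//; lra.
move: s0L c0L; rewrite !in_itv/= => /andP[s0 sL] /andP[c0 cL].
have [cs|/ltW sc] := leP c s.
  by have := key c s c0 cs sL; rewrite fc0 subr0.
by have := key s c s0 sc cL; rewrite fc0 sub0r sqrrN.
Qed.

Lemma stable_short (R : realType) (kappa sigma1 sigma2 L : R) :
  0 < L -> L * (1 + kappa ^+ 2 + `|sigma1| + `|sigma2|) < 1 ->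
  stable kappa sigma1 sigma2 L.
Proof.
move=> L0 Lsmall f [fC1 f0] [s s0L /eqP fs].
have [df dfc] := fC1 1.
have fc : continuous f.
  by move=> x; exact/differentiable_continuous/derivable1_diffP.
have f'c : continuous (derive1 f).
  by rewrite (_ : derive1 f = 'D_1 f)//; apply/funext => x; rewrite derive1E.
have f'2c : continuous (fun x => derive1 f x ^+ 2).
  by move=> x; apply: (continuousM (f'c x) (f'c x)).
have [G dG _] := continuous_antiderivative L0 f'2c.
have intc : continuous (fun x => derive1 f x ^+ 2 - kappa ^+ 2 * f x ^+ 2).
  move=> x; apply: (continuousB (f'2c x)).
  apply: continuousM; first exact: cst_continuous.
  exact: (continuousM (fc x) (fc x)).
have [H dH HE] := continuous_antiderivative L0 intc.
have f2le := mean_zero_sqr_le L0 (fun x _ => df x) fc dG f0.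
set I := G L - G 0 in f2le.
(* At the point [s] where [f] is nonzero, [0 < f s ^+ 2 <= L * I]. *)
have I0 : 0 < I.
  rewrite -(pmulr_rgt0 _ L0); apply: lt_le_trans (f2le s s0L).
  by rewrite exprn_even_gt0.
(* [H - G] is an antiderivative of [- kappa ^+ 2 * f ^+ 2]. The linear term compensates for it by
   the pointwise bound on [f ^+ 2], so [K 0 <= K L], that is,
   [H L - H 0 >= I - kappa ^+ 2 * L ^+ 2 * I]. *)
pose K : R -> R := H - G + (kappa ^+ 2 * (L * I)) *: id.
have dK : {in `[0, L], forall x : R,
    is_derive x 1 K (kappa ^+ 2 * (L * I - f x ^+ 2))}.
  move=> x xL; have dH' := dH x xL; have dG' := dG x xL.
  apply: is_derive_eq; rewrite /GRing.scale/=; ring.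
have := is_derive_ge0_le (ltW L0) dK.
have dK0 : {in `[0, L], forall x, 0 <= kappa ^+ 2 * (L * I - f x ^+ 2)}.
  by move=> x xL; rewrite mulr_ge0 ?sqr_ge0 ?subr_ge0 ?f2le.
move=> /(_ dK0); rewrite /K !fctE /GRing.scale/= => KL.
have bnd sg x : x \in `[0, L] -> sg * f x ^+ 2 <= `|sg| * (L * I).
  move=> xL; apply: (@le_trans _ _ (`|sg| * f x ^+ 2)).
    by rewrite ler_wpM2r ?sqr_ge0 ?ler_norm.
  by rewrite ler_wpM2l ?f2le.
have b1 := bnd sigma1 0 (ltac:(by rewrite in_itv/= lexx ltW)).
have b2 := bnd sigma2 L (ltac:(by rewrite in_itv/= lexx ltW)).
rewrite /second_variation HE.
(* The summand 1 in the smallness condition forces [L < 1], hence [L ^+ 2 <= L]: the curvature term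
   becomes linear in [L], like the boundary terms. *)
have L1 : L < 1.
  apply: le_lt_trans Lsmall; rewrite ler_peMr ?(ltW L0)// -!addrA lerDl.
  by rewrite !addr_ge0 ?sqr_ge0.
have LI0 : 0 < L * I by rewrite mulr_gt0.
have k1 : kappa ^+ 2 * (L * I) * L <= kappa ^+ 2 * (L * I).
  exact: ler_piMr (mulr_ge0 (sqr_ge0 _) (ltW LI0)) (ltW L1).
have LDI : L * (1 + kappa ^+ 2 + `|sigma1| + `|sigma2|) * I < 1 * I.
  by rewrite ltr_pM2r.
have IE : G L - G 0 = I by [].
(* The second variation is at least [I] minus [L * I] times the sum of [kappa ^+ 2], |sigma1| and
   |sigma2|; by [LDI] this exceeds [L * I], which is positive. *)
clearbody I; lra.
Qed.

Theorem proposition26 (R : realType) (kappa sigma1 sigma2 : R) :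
  exists2 L0 : R, 0 < L0 &
    forall (Omega A B : set (R * R)) (gamma : R -> R * R) (L : R),
      bounded_set Omega -> convex_set Omega -> open Omega ->
      minimal_partition Omega A B gamma L ->
      constant_curvature gamma L kappa ->
      boundary_C2_curvature Omega (gamma 0) sigma1 ->
      boundary_C2_curvature Omega (gamma L) sigma2 ->
      L < L0 ->
      stable kappa sigma1 sigma2 L.
Proof.
have D0 : 0 < 1 + kappa ^+ 2 + `|sigma1| + `|sigma2|.
  by rewrite -!addrA ltr_pwDl// !addr_ge0 ?sqr_ge0.
(* The threshold depends on the three curvatures alone; [L < L0] is the smallness condition of
   [stable_short] after division. *)
exists (1 + kappa ^+ 2 + `|sigma1| + `|sigma2|)^-1; first by rewrite invr_gt0.
move=> Omega A B gamma L _ _ _ [[[L0 _ _ _] _] _] _ _ _ LL0.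
by apply: stable_short => //; rewrite -ltr_pdivlMr// div1r.
Qed.
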